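(* For every $\varepsilon>0$ and every integer $k\ge 3$ there exists an integer $m$ such that if an $m$-partite graph $G$ with nonempty vertex classes $V_1,\dots,V_m$ satisfies \[ \sum_{x\in V_i} d_j(x)^2\ \ge\ \Bigl(\bigl(\tfrac{k-2}{k-1}\bigr)^2+\varepsilon\Bigr)|V_i|\,|V_j|^2 \] whenever $1\le i<j\le m$, then $G$ contains a clique $K_k$.
   Context: An $m$-partite graph $G=(V,E)$ has vertex set partitioned as $V=V_1\cup\dots\cup V_m$ (disjoint) with no edges inside any $V_i$. For a vertex $x\in V$ and $j\in[m]$, $d_j(x)$ denotes the number of neighbours of $x$ in $V_j$. $K_k$ is the complete graph on $k$ vertices. *)

(* Defs.v *)
From mathcomp Require Import all_boot.

Set Implicit Arguments.
Unset Strict Implicit.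
Unset Printing Implicit Defensive.

Definition simple_graph (T : finType) (e : rel T) : Prop :=
  symmetric e /\ irreflexive e.

(* The classes are indexed by 0, ..., m-1 instead of 1, ..., m, and may be
   empty. *)
Definition multipartite (T : finType) (e : rel T) (m : nat)
    (V : 'I_m -> {set T}) : Prop :=
  [/\ \bigcup_(i < m) V i = [set: T],
      forall i j : 'I_m, i != j -> [disjoint V i & V j]
    & forall (i : 'I_m) (x y : T), x \in V i -> y \in V i -> ~~ e x y].

Definition deg_in (T : finType) (e : rel T) (A : {set T}) (x : T) : nat :=
  #|[set y in A | e x y]|.

Definition contains_clique (T : finType) (e : rel T) (k : nat) : Prop :=
  exists K : {set T},
    #|K| = k /\ forall x y : T, x \in K -> y \in K -> x != y -> e x y.

(* Main.v *)
(** Induction on the size of the clique, in the spirit of Erdos's proof of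
    Turan's theorem. Write f_B(y) = d_B(y) / |B|. Choose a vertex x with
    f_B(x) >= a for many classes B, where a, a multiple of a small d, is maximal
    in the sense that f_B(y) >= a + d holds for far fewer classes B, whatever
    the vertex y. Double counting then makes f_B <= a + d outside a proportion d
    of A, for all pairs A, B of a still long subsequence of these classes.
    If the neighbourhood of x contains no smaller clique, some pair in it
    violates the hypothesis of the previous case, whose constant is c'; hence,
    up to O(d), the mean of f_B^2 over A is at most
    (1 - a) a^2 + a (1 - a + a c')^2, a cubic whose maximum over a >= 0
    is c^2, attained at a = c. *)

Require Import Defs.
From mathcomp Require Import all_boot all_order all_algebra.
From mathcomp Require Import reals.
From mathcomp Require Import ring lra.

Set Implicit Arguments.
Unset Strict Implicit.
Unset Printing Implicit Defensive.

Import Order.TTheory GRing.Theory Num.Theory.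
Local Open Scope ring_scope.

(** * Selection in finite sequences *)

Lemma last_true_before (P : pred nat) (n : nat) :
  P 0%N -> ~~ P n -> exists2 t, (t < n)%N & P t && ~~ P t.+1.
Proof.
move=> P0; elim: n => [|n IHn]; first by rewrite P0.
move=> PnS; case: (boolP (P n)) => [Pn|/IHn[t tn Pt]].
  by exists n; rewrite ?Pn.
by exists t => //; apply: ltnW.
Qed.

(* Greedy choice: keep the head and discard its at most D bad partners. *)
Lemma subseq_pairwise_free (S : eqType) (bad : rel S) (D n : nat) (s : seq S) :
  (forall A, A \in s -> count (bad A) s <= D)%N -> (n * D.+1 <= size s)%N ->
  exists s', [/\ subseq s' s, size s' = n & pairwise (fun A B => ~~ bad A B) s'].
Proof.
elim: n s => [|n IHn] s badD; first by exists [::]; rewrite sub0seq.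
case: s badD => [//|A s] badD; rewrite mulSn /= addSn ltnS => size_s.
pose s1 := filter (predC (bad A)) s.
have badA : (count (bad A) s <= D)%N.
  by apply: leq_trans (badD A (mem_head _ _)); rewrite /= leq_addl.
have badD1 B : B \in s1 -> (count (bad B) s1 <= D)%N.
  rewrite mem_filter => /andP[_ Bs].
  apply: leq_trans (badD B (mem_behead (s := A :: s) Bs)); rewrite /= -[leqLHS]add0n leq_add //.
  by apply: leq_count_subseq; apply: filter_subseq.
have [|s2 [sub2 size2 free2]] := IHn s1 badD1.
  rewrite size_filter -(leq_add2l (count (bad A) s)) count_predC.
  by apply: leq_trans size_s; rewrite leq_add2r.
exists (A :: s2); split.
- by rewrite /= eqxx; apply: subseq_trans sub2 (filter_subseq _ _).
- by rewrite /= size2.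
- rewrite /= free2 andbT; apply/allP => B /(mem_subseq sub2).
  by rewrite mem_filter => /andP[].
Qed.

(** * Inequalities over the reals *)

(** Minkowski's inequality for the quadratic mean of [f] and a constant, obtained without square
    roots by weighing [f y] against [u]. The case [u = 0] is separate because the argument cancels a
    factor [u]. *)
Lemma sum_sqrD_le (R : realFieldType) (T : finType) (A : {set T}) (f : T -> R)
    (u w : R) :
  0 <= u -> 0 <= w -> (forall y, 0 <= f y) ->
  \sum_(y in A) f y ^+ 2 <= #|A|%:R * u ^+ 2 ->
  \sum_(y in A) (f y + w) ^+ 2 <= #|A|%:R * (u + w) ^+ 2.
Proof.
move=> u0 w0 f0 le_sq.
have sum_const (c : R) : \sum_(y in A) c = #|A|%:R * c.
  by rewrite sumr_const mulr_natl.
have [u_eq0|u_neq0] := eqVneq u 0.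
  have /eqP : \sum_(y in A) f y ^+ 2 = 0.
    apply/eqP; rewrite eq_le sumr_ge0 => [|y _]; last exact: sqr_ge0.
    by rewrite (le_trans le_sq) // u_eq0 expr0n mulr0.
  rewrite psumr_eq0 => [/allP f_eq0|y _]; last exact: sqr_ge0.
  rewrite u_eq0 add0r -sum_const; apply: ler_sum => y yA.
  have /implyP/(_ yA) := f_eq0 y (mem_index_enum y).
  by rewrite sqrf_eq0 => /eqP ->; rewrite add0r.
have u_gt0 : 0 < u by rewrite lt0r u_neq0.
rewrite -(ler_pM2l u_gt0) mulr_sumr.
have : \sum_(y in A) u * (f y + w) ^+ 2
    <= \sum_(y in A) (u + w) * (f y ^+ 2 + u * w).
  apply: ler_sum => y _; rewrite -subr_ge0.
  have -> : (u + w) * (f y ^+ 2 + u * w) - u * (f y + w) ^+ 2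
      = w * (f y - u) ^+ 2 by ring.
  by rewrite mulr_ge0 // sqr_ge0.
move/le_trans; apply; rewrite -mulr_sumr big_split /= sum_const.
have -> : u * (#|A|%:R * (u + w) ^+ 2)
    = (u + w) * (#|A|%:R * u ^+ 2 + #|A|%:R * (u * w)) by ring.
by rewrite ler_wpM2l ?addr_ge0 // lerD2r.
Qed.

(* The paper's (k - 2) / (k - 1), at k = n + 2. *)
Definition turan (R : realFieldType) (n : nat) : R := n%:R / n.+1%:R.

(** The right side minus the left has a double root at [a = turan R n.+1]; the remaining factor is
    linear in [a] and positive for [a >= 0]. *)
Lemma turan_step (R : realFieldType) (n : nat) (a : R) : 0 <= a ->
  (1 - a) * a ^+ 2 + a * (1 - a + a * turan R n) ^+ 2 <= turan R n.+1 ^+ 2.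
Proof.
move=> a0; rewrite -subr_ge0 /turan.
have n0 : 0 <= n%:R :> R by rewrite ler0n.
rewrite -[n.+2%:R]natr1 -![n.+1%:R]natr1.
set r : R := n%:R in n0 *.
have -> : ((r + 1) / (r + 1 + 1)) ^+ 2
    - ((1 - a) * a ^+ 2 + a * (1 - a + a * (r / (r + 1))) ^+ 2)
  = (a - (r + 1) / (r + 1 + 1)) ^+ 2
     * (r * (r + 2) / (r + 1) ^+ 2 * a + 1).
  by field; rewrite !lt0r_neq0 //; lra.
rewrite mulr_ge0 ?sqr_ge0 // addr_ge0 // mulr_ge0 // divr_ge0 ?sqr_ge0 //.
by rewrite mulr_ge0 // addr_ge0.
Qed.

(** The 7 is 1 + 3 + 3: the isolated [d], and at most [3 * d] for perturbing each of the two
    squares, whose bases lie in [0, 1]. *)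
Lemma turan_step_slack (R : realFieldType) (n : nat) (a d : R) :
  0 <= a <= 1 -> 0 <= d <= 1 ->
  d + (1 - a) * (a + d) ^+ 2 + a * (1 - a + a * (turan R n + d)) ^+ 2
    <= turan R n.+1 ^+ 2 + 7 * d.
Proof.
move=> /andP[a0 a1] /andP[d0 d1]; have := turan_step n a0.
have c0 : 0 <= turan R n by rewrite divr_ge0.
have c1 : turan R n <= 1 by rewrite ler_pdivrMr // mul1r ler_nat.
move: (turan R n) c0 c1 => c c0 c1 le_c.
have dd : d ^+ 2 <= d by rewrite expr2 ler_piMl.
have le1 : (1 - a) * (a + d) ^+ 2 <= (1 - a) * a ^+ 2 + 3 * d.
  have : (1 - a) * (2 * a * d + d ^+ 2) <= 1 * (3 * d).
    apply: ler_pM; nra.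
  nra.
have le2 : a * (1 - a + a * (c + d)) ^+ 2 <= a * (1 - a + a * c) ^+ 2 + 3 * d.
  set q := 1 - a + a * c.
  have q0 : 0 <= q by rewrite /q; nra.
  have q1 : q <= 1 by rewrite /q; nra.
  have -> : 1 - a + a * (c + d) = q + a * d by rewrite /q; ring.
  have ad0 : 0 <= a * d by rewrite mulr_ge0.
  have ad1 : a * d <= d by rewrite ler_piMl.
  have : a * (2 * q * (a * d) + (a * d) ^+ 2) <= 1 * (3 * d).
    apply: ler_pM => //; first nra.
    have : q * (a * d) <= 1 * d by apply: ler_pM.
    have : (a * d) ^+ 2 <= d ^+ 2 by rewrite lerXn2r // nnegrE.
    lra.
  nra.
lra.
Qed.

(** * Degrees into classes and dense pairs *)

Section Degrees.
Variables (T : finType) (e : rel T).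
Implicit Types (A B : {set T}) (x y : T).

Lemma deg_in_le_card B y : (deg_in e B y <= #|B|)%N.
Proof. by apply: subset_leq_card; apply/subsetP => z; rewrite inE => /andP[]. Qed.

Lemma deg_in_sub B B' y : B' \subset B ->
  (deg_in e B y + #|B'| <= deg_in e B' y + #|B|)%N.
Proof.
move=> sub; rewrite -(cardsID B' B) (setIidPr sub) addnCA addnC leq_add2l.
rewrite /deg_in -(cardsID B' [set z in B | e y z]) leq_add //.
  by apply: subset_leq_card; apply/subsetP => z; rewrite !inE => /andP[/andP[_ ->] ->].
by apply: subset_leq_card; apply/subsetP => z; rewrite !inE => /andP[-> /andP[-> _]].
Qed.

(* A' and B' play the role of the neighbourhoods of a vertex of nearly maximal
   degree. The vertices of A outside A' have
   relative degree at most b, up to the exceptional proportion d; those of A'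
   are adjacent to at most B \ B' and, on average, a proportion s of B'. *)
Lemma sum_sqr_deg_le (R : realFieldType) A B A' B' (a b s d : R) :
  A' \subset A -> B' \subset B -> 0 <= a -> 0 <= b -> 0 <= s <= 1 ->
  a * #|A|%:R <= #|A'|%:R -> a * #|B|%:R <= #|B'|%:R ->
  #|[set y in A | b * #|B|%:R < (deg_in e B y)%:R]|%:R <= d * #|A|%:R ->
  \sum_(y in A') (deg_in e B' y)%:R ^+ 2 <= s ^+ 2 * #|A'|%:R * #|B'|%:R ^+ 2 ->
  \sum_(y in A) (deg_in e B y)%:R ^+ 2
    <= (d + (1 - a) * b ^+ 2 + a * (1 - a + a * s) ^+ 2)
       * #|A|%:R * #|B|%:R ^+ 2.
Proof.
move=> subA subB a0 b0 /andP[s0 s1] aA aB few sum'.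
pose f y : R := (deg_in e B y)%:R.
(* Off [E], [g] is just the squared degree. On [A'] the minimum keeps two bounds available, the cap
   [b] and the average coming from [B']. *)
pose g y := Num.min (f y ^+ 2) ((b * #|B|%:R) ^+ 2).
have f0 y : 0 <= f y by rewrite ler0n.
have sum_const (C : {set T}) (c : R) : \sum_(y in C) c = #|C|%:R * c.
  by rewrite sumr_const mulr_natl.
set E := [set y in A | _] in few.
have f_le y : y \in A -> f y ^+ 2 <= (if y \in E then #|B|%:R ^+ 2 else 0) + g y.
  move=> yA; rewrite inE yA /=; case: ltP => [_|le_b].
    apply: ler_wpDr; first by rewrite le_min !sqr_ge0.
    by rewrite lerXn2r ?nnegrE // ler_nat deg_in_le_card.
  by rewrite add0r le_min lexx lerXn2r ?nnegrE // mulr_ge0.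
apply: le_trans (ler_sum _ f_le) _.
rewrite big_split /= -big_mkcondr /=.
have -> : \sum_(y in A | y \in E) #|B|%:R ^+ 2 = #|E|%:R * #|B|%:R ^+ 2 :> R.
  rewrite -sum_const; apply: eq_bigl => y.
  by rewrite inE; case: (y \in A).
rewrite (big_setID A') /= (setIidPr subA).
have gD : \sum_(y in A :\: A') g y
    <= (#|A|%:R - #|A'|%:R) * (b * #|B|%:R) ^+ 2.
  have -> : #|A|%:R - #|A'|%:R = #|A :\: A'|%:R :> R.
    by rewrite -(cardsID A' A) (setIidPr subA) natrD addrC addKr.
  by rewrite -sum_const; apply: ler_sum => y _; rewrite ge_min lexx orbT.
have gb : \sum_(y in A') g y <= #|A'|%:R * (b * #|B|%:R) ^+ 2.
  by rewrite -sum_const; apply: ler_sum => y _; rewrite ge_min lexx orbT.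
have gq : \sum_(y in A') g y <= #|A'|%:R * ((1 - a + a * s) * #|B|%:R) ^+ 2.
  have leB : #|B'|%:R <= #|B|%:R :> R by rewrite ler_nat subset_leq_card.
  apply: (@le_trans _ _ (\sum_(y in A')
    ((deg_in e B' y)%:R + (#|B|%:R - #|B'|%:R)) ^+ 2)).
    apply: ler_sum => y _; rewrite ge_min; apply/orP; left.
    have le_f : f y <= (deg_in e B' y)%:R + (#|B|%:R - #|B'|%:R).
      by rewrite addrA lerBrDr -!natrD ler_nat deg_in_sub.
    by rewrite lerXn2r ?nnegrE // (le_trans _ le_f).
  apply: le_trans (@sum_sqrD_le R T A' _ (s * #|B'|%:R) _ _ _ _ _) _ => //.
  - by rewrite mulr_ge0.
  - by rewrite subr_ge0.
  - by rewrite exprMn [leRHS]mulrCA [leRHS]mulrA.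
  (* Since [s <= 1], the left side decreases as [B'] grows, so the worst case is
     [#|B'| = a * #|B|]. *)
  have le_q : s * #|B'|%:R + (#|B|%:R - #|B'|%:R) <= (1 - a + a * s) * #|B|%:R.
    have : (1 - s) * (a * #|B|%:R) <= (1 - s) * #|B'|%:R.
      by rewrite ler_wpM2l ?subr_ge0.
    lra.
  have ge0 : 0 <= s * #|B'|%:R + (#|B|%:R - #|B'|%:R).
    by rewrite addr_ge0 ?subr_ge0 // mulr_ge0.
  rewrite ler_wpM2l // lerXn2r ?nnegrE //; exact: le_trans le_q.
have leE : #|E|%:R * #|B|%:R ^+ 2 <= d * #|A|%:R * #|B|%:R ^+ 2.
  by rewrite ler_wpM2r ?sqr_ge0.
move: gD gb gq leE; rewrite !exprMn.
move: (\sum_(y in A') g y) (\sum_(y in _) g y) => S1 S2.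
move: (1 - a + a * s) => q gD gb gq leE.
have leA : #|A'|%:R <= #|A|%:R :> R by rewrite ler_nat subset_leq_card.
have A0_ge0 : 0 <= #|A|%:R :> R by [].
have B2_ge0 : 0 <= #|B|%:R ^+ 2 :> R by rewrite sqr_ge0.
move: (#|A'|%:R) (#|A|%:R) (#|B|%:R ^+ 2) (#|E|%:R)
  A0_ge0 B2_ge0 gD gb gq leE aA leA
  => A1 A0 B2 E0 A0_ge0 B2_ge0 gD gb gq leE aA leA.
have main : S1 + S2 <= ((1 - a) * b ^+ 2 + a * q ^+ 2) * A0 * B2.
  (* [A'] may exceed the proportion [a]. If [b] is the smaller bound, using it on all of [A]
     suffices; otherwise a larger [A'] only lowers the total. *)
  have [le_bq|/ltW le_qb] := leP (b ^+ 2) (q ^+ 2).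
    have : 0 <= a * A0 * ((q ^+ 2 - b ^+ 2) * B2).
      by rewrite !mulr_ge0 // subr_ge0.
    nra.
  have : 0 <= (A1 - a * A0) * ((b ^+ 2 - q ^+ 2) * B2).
    by rewrite !mulr_ge0 // subr_ge0.
  nra.
nra.
Qed.

(** Relative degree at least [t / N], with denominators cleared; an empty [B] is heavy at every
    level. *)
Definition heavy (N t : nat) x B : bool := (t * #|B| <= N * deg_in e B x)%N.

(** The spacing [1 / N] of the levels doubles as the tolerated proportion of heavy vertices. *)
Definition exceptional (N t : nat) : rel {set T} :=
  [rel A B : {set T} | (#|A| < N * #|[set y in A | heavy N t y B]|)%N].

(** Double count the pairs of a vertex of [A] and a class heavy for it: an exceptional class
    accounts for more than [#|A| / N] pairs, a vertex for at most [n]. *)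
Lemma count_exceptional (N t n : nat) A (s : seq {set T}) :
  (forall y, y \in A -> count (heavy N t y) s <= n)%N ->
  (count (exceptional N t A) s <= N * n)%N.
Proof.
move=> count_le; have [A0|A_gt0] := posnP #|A|.
  rewrite (@eq_count _ _ pred0) ?count_pred0 // => B /=; apply/negbTE.
  rewrite -leqNgt A0 leqn0 muln_eq0 cards_eq0 -subset0; apply/orP; right.
  by apply/subsetP => y; rewrite inE (cards0_eq A0) inE.
rewrite -(leq_pmul2l A_gt0).
rewrite -sum1_count big_distrr /=.
apply: (@leq_trans (\sum_(B <- s) N * #|[set y in A | heavy N t y B]|)).
  rewrite big_mkcond /=; apply: leq_sum => B _; case: ifP => // /ltnW.
  by rewrite muln1.
rewrite -big_distrr /= mulnCA leq_mul2l; apply/orP; right.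
under eq_bigr => B _ do
  rewrite -sum1_card (eq_bigl _ _ (fun y => in_set _ y)) big_mkcondr.
rewrite exchange_big /= -sum_nat_const; apply: leq_sum => y yA.
by rewrite -big_mkcond sum1_count; apply: count_le.
Qed.

(* The inequality is strict, so that A and B are automatically nonempty. *)
Definition dense (R : realFieldType) (c : R) : rel {set T} :=
  [rel A B : {set T} | c * #|A|%:R * #|B|%:R ^+ 2
               < \sum_(x in A) (deg_in e B x)%:R ^+ 2].

Lemma dense_edge (R : realFieldType) (c : R) A B :
  0 <= c -> dense c A B -> exists x y, [/\ x \in A, y \in B & e x y].
Proof.
move=> c0 dAB; have : 0 < \sum_(x in A) (deg_in e B x)%:R ^+ 2 :> R.
  by apply: le_lt_trans dAB; rewrite !mulr_ge0 ?sqr_ge0.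
have [/exists_inP[x xA]|] := boolP [exists (x | x \in A), (0 < deg_in e B x)%N].
  by move=> /card_gt0P[y]; rewrite inE => /andP[yB exy] _; exists x, y.
move=> /exists_inPn no_edge; rewrite big1 ?ltxx // => x xA.
by have := no_edge x xA; rewrite -leqNgt leqn0 => /eqP ->; rewrite expr0n.
Qed.

(** By contraposition: sparse neighbourhoods allow [sum_sqr_deg_le] with [a = t / N], [b = a + d]
    and [s = turan R n + d], and [turan_step_slack] then contradicts the density of [A], [B]. *)
Lemma dense_nbhd (R : realFieldType) (n N t : nat) (x : T) A B :
  let d := N%:R^-1 : R in
  (t <= N)%N -> (n < N)%N ->
  heavy N t x A -> heavy N t x B -> ~~ exceptional N t.+1 A B ->
  dense (turan R n.+1 ^+ 2 + 7 * d) A B ->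
  dense (turan R n ^+ 2 + d ^+ 2)
    [set y in A | e x y] [set y in B | e x y].
Proof.
move=> d tN nN hA hB excAB; apply: contraLR; rewrite /= -!leNgt => sparse.
have N_gt0 : 0 < N%:R :> R by rewrite ltr0n (leq_ltn_trans _ nN).
have d0 : 0 <= d by rewrite invr_ge0 ltW.
have d1 : d <= 1 by rewrite invf_le1 // ler1n (leq_ltn_trans _ nN).
have Nd : N%:R * d = 1 by rewrite mulfV // gt_eqF.
have c0 : 0 <= turan R n by rewrite divr_ge0.
(* The bound [s <= 1] is where [n < N] enters, as [1 - turan R n] is [1 / (n + 1)]. *)
have c1 : turan R n + d <= 1.
  rewrite -lerBrDl.
  have -> : 1 - turan R n = n.+1%:R^-1.
    by rewrite /turan -natr1; field; rewrite natr1 pnatr_eq0.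
  by rewrite lef_pV2 ?posrE // ler_nat.
clearbody d; pose a := t%:R * d.
have a0 : 0 <= a by rewrite mulr_ge0.
have Na : N%:R * a = t%:R by rewrite /a mulrCA Nd mulr1.
have a1 : a <= 1 by rewrite -Nd ler_wpM2r // ler_nat.
have heavyE C : heavy N t x C -> a * #|C|%:R <= #|[set y in C | e x y]|%:R.
  rewrite /heavy -(ler_nat R) !natrM => hC.
  by rewrite -(ler_pM2l N_gt0) mulrA Na.
have few : #|[set y in A | (a + d) * #|B|%:R < (deg_in e B y)%:R]|%:R
    <= d * #|A|%:R.
  rewrite -(ler_pM2l N_gt0) mulrA Nd mul1r -natrM ler_nat.
  move: excAB; rewrite /= -leqNgt; apply: leq_trans; rewrite leq_mul2l.
  apply/orP; right; apply: subset_leq_card; apply/subsetP => y.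
  rewrite !inE /heavy => /andP[-> /ltW]; rewrite -(ler_pM2l N_gt0).
  by rewrite mulrA mulrDr Na Nd natr1 -!natrM ler_nat.
apply: le_trans (@sum_sqr_deg_le R A B [set y in A | e x y]
  [set y in B | e x y] a (a + d) (turan R n + d) d _ _ a0 _ _ _ _ few _) _.
- by apply/subsetP => y; rewrite inE => /andP[].
- by apply/subsetP => y; rewrite inE => /andP[].
- by rewrite addr_ge0.
- by rewrite addr_ge0.
- exact: heavyE.
- exact: heavyE.
- apply: le_trans sparse _; rewrite !ler_wpM2r ?sqr_ge0 //.
  rewrite sqrrD lerD2r lerDl mulrn_wge0 // mulr_ge0 //.
- rewrite !ler_wpM2r ?sqr_ge0 //.
  by apply: turan_step_slack; rewrite ?a0 ?d0.
Qed.

End Degrees.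

(** * Induction on the size of the clique *)

(* The set U lets the induction hypothesis return a clique inside the
   neighbourhood of a vertex. *)
Lemma clique_of_pairwise_dense (R : realType) (n : nat) (eps : R) : 0 < eps ->
  exists m : nat, forall (T : finType) (e : rel T) (U : {set T})
      (s : seq {set T}),
    symmetric e -> irreflexive e -> all (fun A : {set T} => A \subset U) s ->
    pairwise (dense e (turan R n ^+ 2 + eps)) s -> (m <= size s)%N ->
    exists K : {set T}, [/\ K \subset U, #|K| = n.+2
      & forall x y, x \in K -> y \in K -> x != y -> e x y].
Proof.
elim: n eps => [|n IHn] eps eps_gt0.
  exists 2%N => T e U [|A [|B s]] // e_sym e_irr /and3P[AU BU _] /=.
  case/andP=> /andP[dAB _] _ _.
  have [|x [y [xA yB exy]]] := dense_edge _ dAB.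
    by rewrite addr_ge0 ?sqr_ge0 // ltW.
  exists [set x; y]; split.
  - by rewrite subUset !sub1set (subsetP AU) ?(subsetP BU).
  - by rewrite cards2; case: eqVneq exy => // ->; rewrite e_irr.
  - move=> u v; rewrite !inE => /orP[]/eqP-> /orP[]/eqP-> //; rewrite ?eqxx //.
    by rewrite e_sym.
(* Large enough for both [7 * d <= eps] and the condition [n < N] of [dense_nbhd]. *)
pose N := (Num.truncn (7 / eps) + n).+1.
have nN : (n < N)%N by rewrite ltnS leq_addl.
pose d : R := N%:R^-1.
have d_gt0 : 0 < d by rewrite invr_gt0 ltr0n.
have d_eps : 7 * d <= eps.
  rewrite ler_pdivrMr ?ltr0n // mulrC -ler_pdivrMr //.
  apply: (le_trans (ltW (truncnS_gt _))).
  by rewrite ler_nat ltnS leq_addr.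
have [|m IHm] := IHn (d ^+ 2); first by rewrite exprn_gt0.
(* If fewer than [i] classes are heavy one level up, each class has at most [N * i] exceptional
   partners, so [g i] classes leave [m.+2] after the greedy choice. Taking [m.+2] rather than [m]
   keeps [lvl 0] at least 2, enough to find an edge. *)
pose g i := (m.+2 * (N * i).+1)%N.
pose lvl t := iter (N.+1 - t) g 2%N.
have lvlS t : (t < N.+1)%N -> lvl t = g (lvl t.+1).
  by move=> tN; rewrite /lvl subSn.
exists (lvl 0%N) => T e U s e_sym e_irr sU s_dense size_s.
have c0 : 0 <= turan R n.+1 ^+ 2 + eps by rewrite addr_ge0 ?sqr_ge0 // ltW.
have edge_in s' : subseq s' s -> (2 <= size s')%N ->
    exists A B x y, [/\ A \in s', B \in s', x \in A, y \in B & e x y].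
  case: s' => [|A [|B s']] // sub _.
  have /= /andP[/andP[dAB _] _] := subseq_pairwise sub s_dense.
  have [x [y [xA yB exy]]] := dense_edge c0 dAB.
  by exists A, B, x, y; rewrite !inE !eqxx orbT.
pose P t := [exists x in U, (lvl t <= count (heavy e N t x) s)%N].
have P0 : P 0%N.
  have [|A [B [x [_ [As _ xA _ _]]]]] := edge_in s (subseq_refl s).
    by rewrite (leq_trans _ size_s) // lvlS // /g mulSn addSn ltnS mulSn.
  apply/exists_inP; exists x; first exact: subsetP (allP sU A As) x xA.
  by rewrite (eq_count (a2 := predT)) ?count_predT // => B'; rewrite /heavy mul0n.
(* A class heavy at level [N.+1] is empty, but among two classes of [s] the later one is nonempty by
   density. *)
have PN : ~~ P N.+1.
  apply/exists_inPn => x _; rewrite -ltnNge ltnNge; apply/negP.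
  rewrite /lvl subnn /= -size_filter.
  move=> /(edge_in _ (filter_subseq _ _))[A [B [y [z [_ Bs _ zB _]]]]].
  move: Bs; rewrite mem_filter => /andP[]; rewrite /heavy leqNgt => /negP[].
  have B_gt0 : (0 < #|B|)%N by apply/card_gt0P; exists z.
  by rewrite mulSn -addn1 addnC leq_add // leq_mul2l deg_in_le_card orbT.
have [t tN /andP[/exists_inP[x xU le_count] /exists_inPn no_next]] :=
  last_true_before P0 PN.
pose s1 := filter (heavy e N t x) s.
have sub1 : subseq s1 s by apply: filter_subseq.
have few A : A \in s1 ->
    (count (exceptional e N t.+1 A) s1 <= N * lvl t.+1)%N.
  move=> /(mem_subseq sub1) As; apply: count_exceptional => y yA.
  have yU : y \in U by apply: subsetP (allP sU A As) y yA.
  apply: leq_trans (leq_count_subseq _ sub1) _.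
  by rewrite ltnW // ltnNge no_next.
have [|s2 [sub2 size2 free2]] := subseq_pairwise_free few (n := m.+2).
  by rewrite size_filter (leq_trans _ le_count) // (lvlS t tN).
pose nbhd (A : {set T}) := [set y in A | e x y].
have [|||K [KU cardK cliqueK]] :=
  IHm T e (nbhd U) (map nbhd s2) e_sym e_irr _ _ _.
- apply/allP => _ /mapP[A As2 ->]; apply/subsetP => y.
  rewrite !inE => /andP[yA ->]; rewrite andbT.
  have /(mem_subseq sub1) As := mem_subseq sub2 As2.
  exact: subsetP (allP sU A As) y yA.
- rewrite pairwise_map.
  have heavy2 : all (heavy e N t x) s2.
    by apply/allP => A /(mem_subseq sub2); rewrite mem_filter => /andP[].
  have dense2 := subseq_pairwise (subseq_trans sub2 sub1) s_dense.
  (* Each pair of classes in [s2] is both dense and not exceptional, and both classes are heavy for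
     [x]: exactly the input of [dense_nbhd]. *)
  move: (conj free2 dense2) => /andP; rewrite -pairwise_relI.
  apply: sub_in_pairwise heavy2 => A B hA hB /andP[excAB dAB].
  apply: (dense_nbhd (tN : t <= N)%N nN hA hB excAB).
  apply: le_lt_trans dAB; rewrite !ler_wpM2r ?sqr_ge0 //.
  by rewrite lerD2l.
- by rewrite size_map size2 -addn2 leq_addr.
have xK : x \notin K.
  by apply/negP => /(subsetP KU); rewrite inE e_irr andbF.
exists (x |: K); split.
- rewrite subUset sub1set xU; apply: subset_trans KU _.
  by apply/subsetP => y; rewrite inE => /andP[].
- by rewrite cardsU1 xK cardK.
- move=> u v; rewrite !in_setU1.
  have ex w : w \in K -> e x w by move=> /(subsetP KU); rewrite inE => /andP[].
  case/predU1P=> [->|uK] /predU1P[->|vK]; rewrite ?eqxx //.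
  + by move=> _; apply: ex.
  + by move=> _; rewrite e_sym; apply: ex.
  + exact: cliqueK.
Qed.

Theorem theorem2p2 (R : realType) (eps : R) (k : nat)
    (eps_gt0 : 0 < eps) (k_ge3 : (3 <= k)%N) :
  exists m : nat,
    forall (T : finType) (e : rel T) (V : 'I_m -> {set T}),
      simple_graph e ->
      multipartite e V ->
      (forall i : 'I_m, V i != set0) ->
      (forall i j : 'I_m, (i < j)%N ->
         \sum_(x in V i) (deg_in e (V j) x)%:R ^+ 2
           >= (((k%:R - 2) / (k%:R - 1)) ^+ 2 + eps)
              * #|V i|%:R * #|V j|%:R ^+ 2) ->
      contains_clique e k.
Proof.
case: k k_ge3 => [|[|n]] // _.
(* Halving [eps] turns the weak inequality into the strict one of [dense], since the classes are
   nonempty. *)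
have [|m clique_m] := clique_of_pairwise_dense n (eps := eps / 2).
  by rewrite divr_gt0.
exists m => T e V [e_sym e_irr] _ V_neq0 V_dense.
have [|||K [_ cardK cliqueK]] :=
  clique_m T e setT (codom V) e_sym e_irr _ _ _; last by exists K.
- by apply/allP => A _; apply: subsetT.
- rewrite codomE pairwise_map.
  have : pairwise ltn (map val (enum 'I_m)).
    by rewrite val_enum_ord -sorted_pairwise ?iota_ltn_sorted //; apply: ltn_trans.
  rewrite pairwise_map.
  apply: sub_pairwise => i j /V_dense; apply: lt_le_trans.
  have -> : (n.+2%:R - 2) / (n.+2%:R - 1) = turan R n.
    rewrite /turan -[n.+2]addn2 natrD addrK -[n.+1]addn1 natrD.
    by congr (_ / _); ring.
  have card_gt0 l : 0 < #|V l|%:R :> R by rewrite ltr0n card_gt0.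
  rewrite !ltr_pM2r ?exprn_gt0 // ltrD2l.
  by rewrite ltr_pdivrMr // ltr_pMr // ltr1n.
- by rewrite size_codom card_ord.
Qed.
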